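(* Let $X, Y$ be unital regular poly-bicategories, and let $f: X \to Y$ be a morphism that is unital, preserves tensor units, and preserves tensors of 1-cells. Suppose that $Y$ is tensor 1-representable, or that $Y$ is right and left 1-closed. Then $f$ is tensor strong.
   Context: A regular 2-polygraph $X$ consists of a set of 0-cells, a set of 1-cells $a: x \to y$ (each with a source and a target 0-cell), and, for all $n,m\ge 1$, a set of 2-cells $p:(a_1,\ldots,a_n)\to(b_1,\ldots,b_m)$, whose input $(a_i)$ and output $(b_j)$ are non-empty composable sequences of 1-cells (the target of each is the source of the next) with the same initial source and the same final target; write $\partial_i^-p=a_i$, $\partial_j^+p=b_j$. Greek capitals denote possibly empty composable sequences of 1-cells, and commas denote concatenation. A (non-unital) regular poly-bicategory is a regular 2-polygraph with operations $\mathrm{cut}_{j,i}$: given $t:(\Gamma)\to(\Delta_1,a,\Delta_2)$ and $s:(\Gamma_1,a,\Gamma_2)\to(\Delta)$, where the displayed $a$ is the $j$-th output of $t$ and the $i$-th input of $s$, such that ($\Gamma_1$ or $\Delta_1$ is empty) and ($\Gamma_2$ or $\Delta_2$ is empty), there is a composite 2-cell $\mathrm{cut}_{j,i}(t,s):(\Gamma_1,\Gamma,\Gamma_2)\to(\Delta_1,\Delta,\Delta_2)$. These satisfy associativity and interchange: whenever three 2-cells can be composed by two cuts, along the same two identified 1-cells, in two different orders, the two results are equal (e.g. $\mathrm{cut}_{j,1}(t,\mathrm{cut}_{i,1}(s,r))=\mathrm{cut}_{i+j-1,1}(\mathrm{cut}_{j,1}(t,s),r)$). No unit cells are part of the structure.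 A morphism is a map of 0-, 1- and 2-cells preserving all boundaries and all cut operations. Universality. A 2-cell $t:(\Gamma)\to(\Delta_1,a,\Delta_2)$, with $a$ in $j$-th position, is universal at $\partial_j^+$ if for all $\Gamma_1,\Gamma_2$ and non-empty $\Delta$ with ($\Gamma_1$ or $\Delta_1$ empty) and ($\Gamma_2$ or $\Delta_2$ empty), every 2-cell $s:(\Gamma_1,\Gamma,\Gamma_2)\to(\Delta_1,\Delta,\Delta_2)$ equals $\mathrm{cut}(t,r)$, composed along $a$, for a unique $r:(\Gamma_1,a,\Gamma_2)\to(\Delta)$. Dually, $t:(\Gamma_1,a,\Gamma_2)\to(\Delta)$, with $a$ in $i$-th position, is universal at $\partial_i^-$ if for all $\Delta_1,\Delta_2$ and non-empty $\Gamma$ with ($\Gamma_1$ or $\Delta_1$ empty) and ($\Gamma_2$ or $\Delta_2$ empty), every $s:(\Gamma_1,\Gamma,\Gamma_2)\to(\Delta_1,\Delta,\Delta_2)$ equals $\mathrm{cut}(r,t)$, composed along $a$, for a unique $r:(\Gamma)\to(\Delta_1,a,\Delta_2)$. A unit on a 1-cell $a$ is a 2-cell $\mathrm{id}_a:(a)\to(a)$ such that every cut with $\mathrm{id}_a$, on either side, returns the other 2-cell. $X$ is unital if every 1-cell has a unit. A morphism of unital regular poly-bicategories is unital if it maps units (on 1-cells) to units. A tensor of $a: x\to y$, $b:y\to z$ is a 2-cell $(a,b)\to(c)$ universal at $\partial_1^+$. $X$ is tensor 1-representable if it is unital and every composable pair of 1-cells has a tensor. $X$ is right 1-closed if it is unital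 and for all $a: x\to y$, $b: x\to z$ there exist $u: y\to z$ and a 2-cell $(a,u)\to(b)$ universal at $\partial_2^-$. $X$ is left 1-closed if it is unital and for all $a: y\to z$, $b: x\to z$ there exist $u: x\to y$ and a 2-cell $(u,a)\to(b)$ universal at $\partial_1^-$. A morphism preserves tensors if it maps each 2-cell $(a,b)\to(c)$ universal at $\partial_1^+$ to a 2-cell universal at $\partial_1^+$. Tensor units. A 1-cell $1_x: x\to x$ is a tensor unit on $x$ if for each 1-cell $a: x\to y$ there is a 2-cell $l_a:(1_x,a)\to(a)$ universal at both $\partial_1^+$ and $\partial_2^-$, and for each 1-cell $b:z\to x$ there is a 2-cell $r_b:(b,1_x)\to(b)$ universal at both $\partial_1^+$ and $\partial_1^-$. A morphism preserves tensor units if it maps tensor units to tensor units. Tensor universality. Let $e: x \to x'$ be a 1-cell. It is tensor left universal if for each 1-cell $a: x\to y$ there exist a 1-cell $u: x'\to y$ and a 2-cell $(e,u)\to(a)$ universal at both $\partial_1^+$ and $\partial_2^-$, and for each 1-cell $a':x'\to y$ there exist a 1-cell $v: x\to y$ and a 2-cell $(e,a')\to(v)$ universal at both $\partial_1^+$ and $\partial_2^-$. It is tensor right universal if for each $b': z\to x'$ there exist $u: z\to x$ and a 2-cell $(u,e)\to(b')$ universal at both $\partial_1^+$ and $\partial_1^-$, and for each $b:z\to x$ there exist $v: z\to x'$ and a 2-cell $(b,e)\to(v)$ universal at both $\partial_1^+$ and $\partial_1^-$. It is tensor universal if it is both tensor left and tensor right universal. A morphism $f: X\to Y$ of unital regular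 poly-bicategories is tensor strong if it is unital, maps tensor universal 1-cells to tensor universal 1-cells, and preserves tensors of 1-cells. *)

(* Defs.v *)
From mathcomp Require Import all_boot.

Set Implicit Arguments.
Unset Strict Implicit.
Unset Printing Implicit Defensive.

(* [chain src tgt x s y]: [s] is a composable sequence of 1-cells from [x] to
   [y]; the empty sequence is composable only from [x] to [x]. *)
Fixpoint chain (C0 C1 : Type) (src tgt : C1 -> C0) (x : C0) (s : seq C1)
    (y : C0) : Prop :=
  if s is a :: s' then src a = x /\ chain src tgt (tgt a) s' y else x = y.

Record polygraph : Type := Polygraph {
  cell0 : Type;
  cell1 : Type;
  cell2 : Type;
  src : cell1 -> cell0;
  tgt : cell1 -> cell0;
  inp : cell2 -> seq cell1;
  out : cell2 -> seq cell1;
  inp_neq_nil : forall p, inp p <> [::];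
  out_neq_nil : forall p, out p <> [::];
  inp_out_parallel : forall p, exists x y,
    chain src tgt x (inp p) y /\ chain src tgt x (out p) y
}.

Section PolygraphTheory.
Variable X : polygraph.
Implicit Types (a : cell1 X) (x y : cell0 X) (t s : cell2 X).

Definition hom1 a x y : Prop := src a = x /\ tgt a = y.

Definition hom2 t (G D : seq (cell1 X)) : Prop := inp t = G /\ out t = D.

(* Positions of inputs and outputs are counted from 0.
   [cuttable j i t s]: the [j]-th output of [t] is the [i]-th input of [s], and
   the planarity condition for cutting [t] and [s] along it holds. *)
Inductive cuttable (j i : nat) t s : Prop :=
  Cuttable (D1 D2 G1 G2 : seq (cell1 X)) a of
    out t = D1 ++ a :: D2 & size D1 = j &
    inp s = G1 ++ a :: G2 & size G1 = i &
    G1 = [::] \/ D1 = [::] & G2 = [::] \/ D2 = [::].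

End PolygraphTheory.

(* [cut] is a partial operation, rendered as a total function: its value
   [cut j i t s] is constrained, and is used, only when [cuttable j i t s].
   The position shifts in the three laws follow the two identified 1-cells
   through the first cut. The laws cover the three ways in which three 2-cells
   can be joined along two 1-cells: the middle 2-cell receives one and emits
   the other ([cutA]), receives both ([cut_inpC]), or emits both
   ([cut_outC]). *)
Record polybicategory : Type := PolyBicategory {
  pgraph :> polygraph;
  cut : nat -> nat -> cell2 pgraph -> cell2 pgraph -> cell2 pgraph;
  cut_boundary : forall (t s : cell2 pgraph) (D1 D2 G1 G2 : seq (cell1 pgraph))
      (a : cell1 pgraph),
    out t = D1 ++ a :: D2 -> inp s = G1 ++ a :: G2 ->
    G1 = [::] \/ D1 = [::] -> G2 = [::] \/ D2 = [::] ->
    hom2 (cut (size D1) (size G1) t s)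
      (G1 ++ inp t ++ G2) (D1 ++ out s ++ D2);
  cutA : forall (t s r : cell2 pgraph) (j i k l : nat),
    cuttable j i t s -> cuttable (j + k) l (cut j i t s) r ->
    cuttable k l s r -> cuttable j (l + i) t (cut k l s r) ->
    cut j (l + i) t (cut k l s r) = cut (j + k) l (cut j i t s) r;
  cut_inpC : forall (t1 t2 s : cell2 pgraph) (j1 j2 i1 i2 : nat),
    i1 < i2 ->
    let i2' := (i2 + size (inp t1)).-1 in
    cuttable j1 i1 t1 s -> cuttable j2 i2' t2 (cut j1 i1 t1 s) ->
    cuttable j2 i2 t2 s -> cuttable j1 i1 t1 (cut j2 i2 t2 s) ->
    cut j2 i2' t2 (cut j1 i1 t1 s) = cut j1 i1 t1 (cut j2 i2 t2 s);
  cut_outC : forall (t s1 s2 : cell2 pgraph) (j1 j2 i1 i2 : nat),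
    j1 < j2 ->
    let j2' := (j2 + size (out s1)).-1 in
    cuttable j1 i1 t s1 -> cuttable j2' i2 (cut j1 i1 t s1) s2 ->
    cuttable j2 i2 t s2 -> cuttable j1 i1 (cut j2 i2 t s2) s1 ->
    cut j2' i2 (cut j1 i1 t s1) s2 = cut j1 i1 (cut j2 i2 t s2) s1
}.

Record morphism (X Y : polybicategory) : Type := Morphism {
  map0 : cell0 X -> cell0 Y;
  map1 : cell1 X -> cell1 Y;
  map2 : cell2 X -> cell2 Y;
  map_src : forall a, src (map1 a) = map0 (src a);
  map_tgt : forall a, tgt (map1 a) = map0 (tgt a);
  map_inp : forall t, inp (map2 t) = map map1 (inp t);
  map_out : forall t, out (map2 t) = map map1 (out t);
  map_cut : forall j i t s, cuttable j i t s ->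
    map2 (cut j i t s) = cut j i (map2 t) (map2 s)
}.

Section Universality.
Variable X : polybicategory.
Implicit Types (a b c e u v : cell1 X) (x y z : cell0 X).
Implicit Types (t s r l : cell2 X) (G D : seq (cell1 X)).

Definition universal_out (j : nat) t : Prop :=
  exists D1 a D2, [/\ out t = D1 ++ a :: D2, size D1 = j &
    forall G1 G2 D s,
      G1 = [::] \/ D1 = [::] -> G2 = [::] \/ D2 = [::] -> D <> [::] ->
      hom2 s (G1 ++ inp t ++ G2) (D1 ++ D ++ D2) ->
      exists! r, hom2 r (G1 ++ a :: G2) D /\ s = cut j (size G1) t r].

Definition universal_inp (i : nat) t : Prop :=
  exists G1 a G2, [/\ inp t = G1 ++ a :: G2, size G1 = i &
    forall D1 D2 G s,
      G1 = [::] \/ D1 = [::] -> G2 = [::] \/ D2 = [::] -> G <> [::] ->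
      hom2 s (G1 ++ G ++ G2) (D1 ++ out t ++ D2) ->
      exists! r, hom2 r G (D1 ++ a :: D2) /\ s = cut (size D1) i r t].

Definition is_unit a t : Prop :=
  [/\ hom2 t [:: a] [:: a],
      forall i s, cuttable 0 i t s -> cut 0 i t s = s
    & forall j s, cuttable j 0 s t -> cut j 0 s t = s].

Definition unital : Prop := forall a, exists t, is_unit a t.

Definition is_tensor a b c t : Prop :=
  hom2 t [:: a; b] [:: c] /\ universal_out 0 t.

Definition tensor_1_representable : Prop :=
  unital /\
  forall x y z a b, hom1 a x y -> hom1 b y z -> exists c t, is_tensor a b c t.

Definition right_1_closed : Prop :=
  unital /\
  forall x y z a b, hom1 a x y -> hom1 b x z ->
    exists u t, [/\ hom1 u y z, hom2 t [:: a; u] [:: b] & universal_inp 1 t].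

Definition left_1_closed : Prop :=
  unital /\
  forall x y z a b, hom1 a y z -> hom1 b x z ->
    exists u t, [/\ hom1 u x y, hom2 t [:: u; a] [:: b] & universal_inp 0 t].

Definition tensor_unit x e : Prop :=
  [/\ hom1 e x x,
      forall y a, hom1 a x y -> exists l,
        [/\ hom2 l [:: e; a] [:: a], universal_out 0 l & universal_inp 1 l]
    & forall z b, hom1 b z x -> exists r,
        [/\ hom2 r [:: b; e] [:: b], universal_out 0 r & universal_inp 0 r]].

Definition tensor_left_universal e : Prop :=
  (forall y a, hom1 a (src e) y -> exists u t,
     [/\ hom1 u (tgt e) y, hom2 t [:: e; u] [:: a],
         universal_out 0 t & universal_inp 1 t]) /\
  (forall y a, hom1 a (tgt e) y -> exists v t,
     [/\ hom1 v (src e) y, hom2 t [:: e; a] [:: v],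
         universal_out 0 t & universal_inp 1 t]).

Definition tensor_right_universal e : Prop :=
  (forall z b, hom1 b z (tgt e) -> exists u t,
     [/\ hom1 u z (src e), hom2 t [:: u; e] [:: b],
         universal_out 0 t & universal_inp 0 t]) /\
  (forall z b, hom1 b z (src e) -> exists v t,
     [/\ hom1 v z (tgt e), hom2 t [:: b; e] [:: v],
         universal_out 0 t & universal_inp 0 t]).

Definition tensor_universal e : Prop :=
  tensor_left_universal e /\ tensor_right_universal e.

End Universality.

Section Preservation.
Variables (X Y : polybicategory) (f : morphism X Y).

Definition unital_morphism : Prop :=
  forall a t, is_unit a t -> is_unit (map1 f a) (map2 f t).

Definition preserves_tensors : Prop :=
  forall a b c t, is_tensor a b c t ->
    is_tensor (map1 f a) (map1 f b) (map1 f c) (map2 f t).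

Definition preserves_tensor_units : Prop :=
  forall x e, tensor_unit x e -> tensor_unit (map0 f x) (map1 f e).

Definition tensor_strong : Prop :=
  [/\ unital_morphism,
      forall e, tensor_universal e -> tensor_universal (map1 f e)
    & preserves_tensors].

End Preservation.

Arguments unital X : clear implicits.
Arguments tensor_1_representable X : clear implicits.
Arguments right_1_closed X : clear implicits.
Arguments left_1_closed X : clear implicits.

(* Main.v *)
Require Import Defs.
From mathcomp Require Import all_boot zify.

Set Implicit Arguments.
Unset Strict Implicit.
Unset Printing Implicit Defensive.

(** Tensor universal 1-cells turn out to be the weakly invertible ones, and weak
    invertibility is expressed by tensors and tensor units alone, which [f]
    preserves. Say that [e : x -> x'] has the weak inverse [e' : x' -> x] when
    there are tensor units [i] on [x] and [i'] on [x'] with tensors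
    [t : (e, e') -> (i)] and [t' : (e', e) -> (i')].

    _Tensor universal implies weakly invertible_, in any regular
    poly-bicategory ([tensor_universal_has_inverse]). Dividing [e] by itself
    on the left yields [p : (e, i') -> (e)], and [i'] is a tensor unit. Its left
    unitor [l : (i', a) -> (a)] is defined by the requirement that [l] and [p]
    have the same composite with a universal [q : (e, a) -> (v)]. Then cutting
    with [l] and with [p] agree on every cell with adjacent inputs [e, a]
    ([unit_triangle]), so that [l] inherits universality from [p]. In the mirror image this gives the unit [i], dividing [i] by [e] gives
    [e'] and [t], and dividing the composite [(e, e', e) -> (i, e) -> (e)] by
    [p] gives [t']. Universality is known at first only in contexts where [e]
    stands on the left; the bending lemma [out_univ_bend] extends it to all
    contexts, by dividing the preceding 1-cell by [e] or tensoring the first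
    output with [e].

    _Weakly invertible implies tensor universal_, in a unital regular
    poly-bicategory which has tensors or has both homs
    ([weak_inverse_tensor_universal]). Start from a tensor
    [w : (e', a) -> (u)], or else from a hom [n : (e, u) -> (a)]; the other of
    the two is obtained by factoring the composite
    [(e, e', a) -> (i, a) -> (a)]. Both composites of [n] and [w] are then [t],
    respectively [t'], followed by a cell [lam : (i, a) -> (a)], respectively
    [lam' : (i', u) -> (u)]. As soon as [lam] and [lam'] are universal on both
    sides, so are [n] and [w] ([zigzag_univ]): they whisker to each other's
    inverses up to invertible corrections. For [lam] this is part of the
    definition of a unit. For [lam'] one of the two universalities follows
    from that of [n] and [w], and it implies the other because [lam'] is a
    unitor followed by an endomorphism of [u] which the unit cell on [u] shows
    to be invertible. No coherence between the chosen unitors is available,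
    which is why the argument keeps track of bijections rather than of
    identities.

    Only left universality is treated directly; right universality is left
    universality in the mirror image, where all sequences are reversed. *)

(** * Boundaries *)

Section Boundaries.
Variable X : polygraph.
Implicit Types (a b c d : cell1 X) (x y z : cell0 X).

Lemma chain_cat x y (s1 s2 : seq (cell1 X)) :
  chain (@src X) (@tgt X) x (s1 ++ s2) y <->
  exists z, chain (@src X) (@tgt X) x s1 z /\ chain (@src X) (@tgt X) z s2 y.
Proof.
elim: s1 x => [|a s1 IH] x /=.
  by split=> [h|[z [-> h]]] //; exists x.
split=> [[h /IH[z [h1 h2]]]|[z [[h h1] h2]]]; first by exists z.
by split=> //; apply/IH; exists z.
Qed.

Lemma hom2_src p a (G : seq (cell1 X)) d D :
  hom2 p (a :: G) (d :: D) -> src a = src d.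
Proof.
by case=> ip op; have [x [y]] := inp_out_parallel p; rewrite ip op /= => -[[-> _] [-> _]].
Qed.

Lemma hom2_tgt p (G : seq (cell1 X)) a D d :
  hom2 p (G ++ [:: a]) (D ++ [:: d]) -> tgt a = tgt d.
Proof.
case=> ip op; have [x [y]] := inp_out_parallel p; rewrite ip op.
by case=> /chain_cat[z [_ /= [_ ->]]] /chain_cat[z' [_ /= [_ ->]]].
Qed.

Lemma hom2_adj p (G : seq (cell1 X)) a b G' D :
  hom2 p (G ++ a :: b :: G') D -> tgt a = src b.
Proof.
case=> ip op; have [x [y]] := inp_out_parallel p; rewrite ip.
by case=> /chain_cat[z [_ /= [_ [-> _]]]].
Qed.

Lemma hom2_inp_neq_nil p (G D : seq (cell1 X)) : hom2 p G D -> G <> [::].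
Proof. by case=> <- _; exact: inp_neq_nil. Qed.

Lemma hom2_out_neq_nil p (G D : seq (cell1 X)) : hom2 p G D -> D <> [::].
Proof. by case=> _ <-; exact: out_neq_nil. Qed.

End Boundaries.

(** * Cuts in context *)

(** The laws of the structure are stated with positions; here they are restated
    with the sequences around the cut 1-cells, so that positions are sizes and
    the [cuttable] conditions reduce to the planarity conditions listed. *)

Section Cuts.
Variable X : polybicategory.
Implicit Types (a b c d e u v : cell1 X) (t s r : cell2 X).
Implicit Types (T G D E F : seq (cell1 X)).

Lemma hom2_cuttable t s T D1 a D2 G1 G2 D :
  hom2 t T (D1 ++ a :: D2) -> hom2 s (G1 ++ a :: G2) D ->
  G1 = [::] \/ D1 = [::] -> G2 = [::] \/ D2 = [::] ->
  cuttable (size D1) (size G1) t s.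
Proof. by move=> [_ ot] [is_ _] c1 c2; apply: (Cuttable ot _ is_). Qed.

Lemma hom2_cut t s T D1 a D2 G1 G2 D :
  hom2 t T (D1 ++ a :: D2) -> hom2 s (G1 ++ a :: G2) D ->
  G1 = [::] \/ D1 = [::] -> G2 = [::] \/ D2 = [::] ->
  hom2 (cut (size D1) (size G1) t s) (G1 ++ T ++ G2) (D1 ++ D ++ D2).
Proof.
by move=> [<- ot] [is_ <-] c1 c2; exact: (cut_boundary ot is_ c1 c2).
Qed.

Lemma cut_assoc t s r T D1 a D2 G1 G2 E1 b E2 F1 F2 D :
  hom2 t T (D1 ++ a :: D2) -> hom2 s (G1 ++ a :: G2) (E1 ++ b :: E2) ->
  hom2 r (F1 ++ b :: F2) D ->
  G1 = [::] \/ D1 = [::] -> G2 = [::] \/ D2 = [::] ->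
  F1 = [::] \/ E1 = [::] -> F2 = [::] \/ E2 = [::] ->
  F1 = [::] \/ D1 = [::] -> F2 = [::] \/ D2 = [::] ->
  cut (size D1) (size F1 + size G1) t (cut (size E1) (size F1) s r) =
  cut (size D1 + size E1) (size F1) (cut (size D1) (size G1) t s) r.
Proof.
move=> ht hs hr c1 c2 c3 c4 c5 c6.
have hts := hom2_cut ht hs c1 c2; have hsr := hom2_cut hs hr c3 c4.
apply: cutA.
- exact: hom2_cuttable ht hs c1 c2.
- rewrite -size_cat; apply: (@hom2_cuttable _ _ _ _ b (E2 ++ D2)).
  + by rewrite -catA; move: hts; rewrite -[(E1 ++ _) ++ _]catA; apply.
  + exact: hr.
  + by case: c3 c5 => [?|->] [?|->]; auto.
  + by case: c4 c6 => [?|->] [?|->]; auto.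
- exact: hom2_cuttable hs hr c3 c4.
- rewrite -size_cat; apply: (@hom2_cuttable _ _ _ _ a D2 _ (G2 ++ F2)).
  + exact: ht.
  + by move: hsr; rewrite -!catA; apply.
  + by case: c1 c5 => [->|?] [->|?]; auto.
  + by case: c2 c6 => [->|?] [->|?]; auto.
Qed.

Lemma cut_interchange t1 t2 s G D1 a H b E2 F1 F2 F3 D :
  hom2 t1 G (D1 ++ [:: a]) -> hom2 t2 H (b :: E2) ->
  hom2 s (F1 ++ a :: F2 ++ b :: F3) D ->
  F1 = [::] \/ D1 = [::] -> F3 = [::] \/ E2 = [::] ->
  cut 0 (size F1 + size G + size F2) t2 (cut (size D1) (size F1) t1 s) =
  cut (size D1) (size F1) t1 (cut 0 (size F1 + (size F2).+1) t2 s).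
Proof.
move=> h1 h2 hs c1 c2.
have hs' : hom2 s ((F1 ++ a :: F2) ++ b :: F3) D by rewrite -catA.
have h1s := hom2_cut h1 hs c1 (or_intror erefl).
have h2s := hom2_cut (D1 := [::]) h2 hs' (or_intror erefl) c2.
have -> : size F1 + size G + size F2 =
    ((size F1 + (size F2).+1) + size (inp t1)).-1.
  by case: h1 => -> _; lia.
apply: cut_inpC; first by lia.
- exact: hom2_cuttable h1 hs c1 (or_intror erefl).
- have -> : ((size F1 + (size F2).+1) + size (inp t1)).-1 =
      size (F1 ++ G ++ F2) by case: h1 => -> _; rewrite !size_cat; lia.
  apply: (@hom2_cuttable _ _ _ [::] b E2 _ F3 _ h2); last exact: c2.
    by move: h1s; rewrite -!catA; apply.
  by right.
- have -> : size F1 + (size F2).+1 = size (F1 ++ a :: F2) by rewrite size_cat.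
  exact: (@hom2_cuttable _ _ _ [::] b E2 _ F3 _ h2 hs' (or_intror erefl) c2).
- apply: (@hom2_cuttable _ _ _ D1 a [::] F1 (F2 ++ H ++ F3) (D ++ E2) h1).
  + by move: h2s; rewrite size_cat /= -!catA.
  + exact: c1.
  + by right.
Qed.

End Cuts.

(** * Universality *)

Section Universal.
Variable X : polybicategory.
Implicit Types (a b c d e u v : cell1 X) (t s r n p q : cell2 X).
Implicit Types (T G D E F : seq (cell1 X)).

Lemma cat_cons_inj (A : Type) (s1 s2 s1' s2' : seq A) x x' :
  s1 ++ x :: s2 = s1' ++ x' :: s2' -> size s1 = size s1' ->
  [/\ s1 = s1', x = x' & s2 = s2'].
Proof.
elim: s1 s1' => [|y s1 IH] [|y' s1'] //= [-> es].
  by rewrite es.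
by case=> /(IH _ es)[-> -> ->].
Qed.

Lemma universal_outE t D1 a D2 : out t = D1 ++ a :: D2 ->
  universal_out (size D1) t <->
  forall G1 G2 D s, G1 = [::] \/ D1 = [::] -> G2 = [::] \/ D2 = [::] ->
    D <> [::] -> hom2 s (G1 ++ inp t ++ G2) (D1 ++ D ++ D2) ->
    exists! r, hom2 r (G1 ++ a :: G2) D /\ s = cut (size D1) (size G1) t r.
Proof.
move=> ot; split=> [[E1 [b [E2 [ot' es]]]]|U]; last by exists D1, a, D2.
by rewrite ot in ot'; have [-> -> ->] := cat_cons_inj ot' (esym es).
Qed.

Lemma universal_inpE t G1 a G2 : inp t = G1 ++ a :: G2 ->
  universal_inp (size G1) t <->
  forall D1 D2 G s, G1 = [::] \/ D1 = [::] -> G2 = [::] \/ D2 = [::] ->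
    G <> [::] -> hom2 s (G1 ++ G ++ G2) (D1 ++ out t ++ D2) ->
    exists! r, hom2 r G (D1 ++ a :: D2) /\ s = cut (size D1) (size G1) r t.
Proof.
move=> it; split=> [[F1 [b [F2 [it' es]]]]|U]; last by exists G1, a, G2.
by rewrite it in it'; have [-> -> ->] := cat_cons_inj it' (esym es).
Qed.

(** For a cell with a single output the planarity conditions on a cut along that
    output are void. For a cell [(e, u) -> (a)] those on a cut along [u] leave
    only trailing outputs [D] of the other cell. Existence and uniqueness of
    factorizations are separated because they are often known for different
    reasons. *)
Definition out_exists T c t := forall G1 G2 D s,
  hom2 s (G1 ++ T ++ G2) D ->
  exists2 r, hom2 r (G1 ++ c :: G2) D & s = cut 0 (size G1) t r.

Definition out_unique c t := forall G1 G2 D r1 r2,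
  hom2 r1 (G1 ++ c :: G2) D -> hom2 r2 (G1 ++ c :: G2) D ->
  cut 0 (size G1) t r1 = cut 0 (size G1) t r2 -> r1 = r2.

Definition out_univ t T c :=
  [/\ hom2 t T [:: c], out_exists T c t & out_unique c t].

Lemma universal_outP t T c : hom2 t T [:: c] ->
  universal_out 0 t <-> out_univ t T c.
Proof.
move=> ht; have [it ot] := ht; rewrite (universal_outE (D1 := [::]) ot) it.
split=> [U|[_ ex un] G1 G2 D s _ _ _]; last first.
  rewrite /= cats0 => /ex[r hr es]; exists r; split=> // r' [hr' es'].
  by apply: (un G1 G2 D) => //; rewrite -es.
split=> // [G1 G2 D s hs|G1 G2 D r1 r2 h1 h2 e12].
  have hD := hom2_out_neq_nil hs.
  by have [||//||r [[]]] := U G1 G2 D s; rewrite /= ?cats0; [right|right| |exists r].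
have hD := hom2_out_neq_nil h1.
have h := hom2_cut (D1 := [::]) ht h1 (or_intror erefl) (or_intror erefl).
have [||r [_ rP]] := U G1 G2 D _ _ _ hD h; [by right|by right|].
by rewrite -(rP r1) // -(rP r2).
Qed.

Definition inp_exists e u a n := forall G D s, G <> [::] ->
  hom2 s (e :: G) (a :: D) ->
  exists2 r, hom2 r G (u :: D) & s = cut 0 1 r n.

Definition inp_unique u n := forall G D r1 r2,
  hom2 r1 G (u :: D) -> hom2 r2 G (u :: D) ->
  cut 0 1 r1 n = cut 0 1 r2 n -> r1 = r2.

Definition inp_univ n e u a :=
  [/\ hom2 n [:: e; u] [:: a], inp_exists e u a n & inp_unique u n].

Lemma universal_inp1P n e u a : hom2 n [:: e; u] [:: a] ->
  universal_inp 1 n <-> inp_univ n e u a.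
Proof.
move=> hn; have [in_ on] := hn.
rewrite (universal_inpE (G1 := [:: e]) (G2 := [::]) in_) on.
split=> [U|[_ ex un] D1 D G s [//|->] _ hG]; last first.
  rewrite /= cats0 => /ex[//|r hr es]; exists r; split=> // r' [hr' es'].
  by apply: (un G D) => //; rewrite -es.
split=> // [G D s hG hs|G D r1 r2 h1 h2 e12].
  by have [||//||r [[]]] := U [::] D G s; rewrite /= ?cats0; [right|left| |exists r].
have hG := hom2_inp_neq_nil h1.
have h := hom2_cut (D1 := [::]) (G1 := [:: e]) h1 hn (or_intror erefl) (or_introl erefl).
have [||r [_ rP]] := U [::] D G _ _ _ hG h; [by right|by left|].
by rewrite -(rP r1) // -(rP r2).
Qed.

Lemma universal_inp0P n e u a : hom2 n [:: u; e] [:: a] ->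
  universal_inp 0 n <->
  (forall G D s, G <> [::] -> hom2 s (G ++ [:: e]) (D ++ [:: a]) ->
   exists2 r, hom2 r G (D ++ [:: u]) & s = cut (size D) 0 r n) /\
  (forall G D r1 r2, hom2 r1 G (D ++ [:: u]) -> hom2 r2 G (D ++ [:: u]) ->
   cut (size D) 0 r1 n = cut (size D) 0 r2 n -> r1 = r2).
Proof.
move=> hn; have [in_ on] := hn.
rewrite (universal_inpE (G1 := [::]) (G2 := [:: e]) in_) on.
split=> [U|[ex un] D D2 G s _ [//|->] hG]; last first.
  move=> /ex[//|r hr es]; exists r; split=> // r' [hr' es'].
  by apply: (un G D) => //; rewrite -es.
split=> [G D s hG hs|G D r1 r2 h1 h2 e12].
  by have [||//||r [[]]] := U D [::] G s; [left|right| |exists r].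
have hG := hom2_inp_neq_nil h1.
have h := hom2_cut (D2 := [::]) (G1 := [::]) h1 hn (or_introl erefl) (or_intror erefl).
have [||r [_ rP]] := U D [::] G _ _ _ hG h; [by left|by right|].
by rewrite -(rP r1) // -(rP r2).
Qed.

End Universal.

(** * Plugging and grafting *)

Section Whiskering.
Variable X : polybicategory.
Implicit Types (a b c d e u v i : cell1 X) (t s r n w p q : cell2 X).
Implicit Types (T G D E F : seq (cell1 X)).

(** Two shapes of cuts suffice for most of the proof. Plugging [t : T -> (c)]
    into [s] at position [n] is [cut 0 n t s]. Grafting [n : (e, u) -> (a)]
    onto the first output of [r : G -> (u, D)] is [cut 0 1 r n], which
    whiskers [r] by [e] on the left; a cell [(a) -> (b)] is composed after [r]
    by [cut 0 0 r h]. The lemmas below are the instances of associativity and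
    interchange for these shapes. *)
Lemma hom2_plug t T c s G1 G2 D :
  hom2 t T [:: c] -> hom2 s (G1 ++ c :: G2) D ->
  hom2 (cut 0 (size G1) t s) (G1 ++ T ++ G2) D.
Proof.
move=> ht hs; rewrite -[D]cats0.
by apply: (@hom2_cut _ _ _ _ [::]) ht hs _ _; right.
Qed.

Lemma hom2_graft r G u D e n a :
  hom2 r G (u :: D) -> hom2 n [:: e; u] [:: a] ->
  hom2 (cut 0 1 r n) (e :: G) (a :: D).
Proof.
move=> hr hn; rewrite -[G]cats0.
by apply: (@hom2_cut _ _ _ _ [::] _ _ [:: e]) hr hn _ _; [right|left].
Qed.

Lemma plug_plug t T c s G1 G2 d r F1 F2 D :
  hom2 t T [:: c] -> hom2 s (G1 ++ c :: G2) [:: d] ->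
  hom2 r (F1 ++ d :: F2) D ->
  cut 0 (size F1 + size G1) t (cut 0 (size F1) s r) =
  cut 0 (size F1) (cut 0 (size G1) t s) r.
Proof.
move=> ht hs hr.
by apply: (@cut_assoc _ _ _ _ T [::] c [::] _ _ [::] d [::] _ _ _ ht hs hr);
  right.
Qed.

Lemma plug_graft t T c r G1 G2 u D e n a :
  hom2 t T [:: c] -> hom2 r (G1 ++ c :: G2) (u :: D) ->
  hom2 n [:: e; u] [:: a] ->
  cut 0 (size G1).+1 t (cut 0 1 r n) = cut 0 1 (cut 0 (size G1) t r) n.
Proof.
move=> ht hr hn.
by apply: (@cut_assoc _ _ _ _ T [::] c [::] _ _ [::] u D [:: e] [::] _ ht hr hn);
  do [by right|by left].
Qed.

Lemma graft_plug t T e r G u D n a :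
  hom2 t T [:: e] -> hom2 r G (u :: D) -> hom2 n [:: e; u] [:: a] ->
  cut 0 (size T) r (cut 0 0 t n) = cut 0 0 t (cut 0 1 r n).
Proof.
move=> ht hr hn.
have := @cut_interchange _ _ _ _ _ [::] _ _ _ _ [::] [::] [::] _ ht hr hn.
by rewrite addn0; apply; [right|left].
Qed.

Lemma graft_graft r G u D e n a e' w b :
  hom2 r G (u :: D) -> hom2 n [:: e; u] [:: a] -> hom2 w [:: e'; a] [:: b] ->
  cut 0 2 r (cut 0 1 n w) = cut 0 1 (cut 0 1 r n) w.
Proof.
move=> hr hn hw.
by apply: (@cut_assoc _ _ _ _ G [::] u D [:: e] [::] [::] a [::] [:: e'] [::] _
  hr hn hw); do [by right|by left].
Qed.

Lemma graft_unary r G u D e n a h b :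
  hom2 r G (u :: D) -> hom2 n [:: e; u] [:: a] -> hom2 h [:: a] [:: b] ->
  cut 0 1 r (cut 0 0 n h) = cut 0 0 (cut 0 1 r n) h.
Proof.
move=> hr hn hh.
by apply: (@cut_assoc _ _ _ _ G [::] u D [:: e] [::] [::] a [::] [::] [::] _
  hr hn hh); do [by right|by left].
Qed.

Lemma unary_unary s G a D h b g c :
  hom2 s G (a :: D) -> hom2 h [:: a] [:: b] -> hom2 g [:: b] [:: c] ->
  cut 0 0 s (cut 0 0 h g) = cut 0 0 (cut 0 0 s h) g.
Proof.
move=> hs hh hg.
by apply: (@cut_assoc _ _ _ _ G [::] a D [::] [::] [::] b [::] [::] [::] _
  hs hh hg); do [by right|by left].
Qed.

Lemma hom2_unary s G a D h b :
  hom2 s G (a :: D) -> hom2 h [:: a] [:: b] -> hom2 (cut 0 0 s h) G (b :: D).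
Proof.
move=> hs hh; rewrite -[G]cats0.
by apply: (@hom2_cut _ _ _ _ [::] _ _ [::]) hs hh _ _; left.
Qed.

Lemma out_comp t T c s G1 G2 d :
  out_univ t T c -> out_univ s (G1 ++ c :: G2) d ->
  out_univ (cut 0 (size G1) t s) (G1 ++ T ++ G2) d.
Proof.
move=> [ht te tu] [hs se su]; split; first exact: hom2_plug ht hs.
- move=> F1 F2 D r hr.
  have [|q hq eq] := te (F1 ++ G1) (G2 ++ F2) D r; first by move: hr; rewrite -!catA.
  have [|p hp ep] := se F1 F2 D q; first by move: hq; rewrite -!catA.
  by exists p; rewrite // -(plug_plug ht hs hp) -ep -size_cat.
- move=> F1 F2 D p1 p2 h1 h2; rewrite -(plug_plug ht hs h1) -(plug_plug ht hs h2) -size_cat => e12.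
  apply: (su F1 F2 D) => //; apply: (tu (F1 ++ G1) (G2 ++ F2) D) => //.
    by move: (hom2_plug hs h1); rewrite -!catA.
  by move: (hom2_plug hs h2); rewrite -!catA.
Qed.

Lemma out_cancel t T c s G1 G2 d :
  out_univ t T c -> hom2 s (G1 ++ c :: G2) [:: d] ->
  out_univ (cut 0 (size G1) t s) (G1 ++ T ++ G2) d ->
  out_univ s (G1 ++ c :: G2) d.
Proof.
move=> [ht te tu] hs [hts tse tsu]; split=> //.
- move=> F1 F2 D r hr.
  have hr' : hom2 r ((F1 ++ G1) ++ c :: (G2 ++ F2)) D by move: hr; rewrite -!catA.
  have [|p hp ep] := tse F1 F2 D (cut 0 (size (F1 ++ G1)) t r).
    by move: (hom2_plug ht hr'); rewrite -!catA.
  exists p => //; apply: (tu (F1 ++ G1) (G2 ++ F2) D) => //.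
    by move: (hom2_plug hs hp); rewrite -!catA.
  by rewrite ep size_cat (plug_plug ht hs hp).
- move=> F1 F2 D p1 p2 h1 h2 e12; apply: (tsu F1 F2 D) => //.
  by rewrite -(plug_plug ht hs h1) -(plug_plug ht hs h2) e12.
Qed.

(** * Units and invertible cells *)

Definition inverse_cells h g a := [/\ hom2 h [:: a] [:: a], hom2 g [:: a] [:: a],
  is_unit a (cut 0 0 h g) & is_unit a (cut 0 0 g h)].

Lemma is_unit_plug a j r G1 G2 D :
  is_unit a j -> hom2 r (G1 ++ a :: G2) D -> cut 0 (size G1) j r = r.
Proof.
move=> [hj U _] hr; apply: U.
by apply: (@hom2_cuttable _ _ _ _ [::] a [::] _ _ _ hj hr); right.
Qed.

Lemma is_unit_unary a j r G D :
  is_unit a j -> hom2 r G (a :: D) -> cut 0 0 r j = r.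
Proof.
move=> [hj _ U] hr; apply: U.
by apply: (@hom2_cuttable _ _ _ _ [::] a D [::] [::] _ hr hj); left.
Qed.

Lemma inverse_out h g a : inverse_cells h g a -> out_univ h [:: a] a.
Proof.
move=> [hh hg uhg ugh]; split=> // [G1 G2 D s|G1 G2 D r1 r2] /=.
  move=> hs; exists (cut 0 (size G1) g s); first exact: (hom2_plug hg hs).
  have := @plug_plug h [:: a] a g [::] [::] a s _ _ _ hh hg hs.
  by rewrite addn0 /= (is_unit_plug uhg hs).
move=> h1 h2 e12.
have := @plug_plug g [:: a] a h [::] [::] a r1 _ _ _ hg hh h1.
have := @plug_plug g [:: a] a h [::] [::] a r2 _ _ _ hg hh h2.
by rewrite -e12 => ->; rewrite (is_unit_plug ugh h1) (is_unit_plug ugh h2).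
Qed.

Lemma inverse_inp h g e u a l :
  inverse_cells h g a -> inp_univ l e u a -> inp_univ (cut 0 0 l h) e u a.
Proof.
move=> [hh hg uhg ugh] [hl le lu]; split.
- exact: hom2_unary hl hh.
- move=> G D s hG hs.
  have [//|r hr er] := le G D (cut 0 0 s g) hG; first exact: hom2_unary hs hg.
  exists r => //; rewrite (graft_unary hr hl hh) -er -(unary_unary hs hg hh).
  by rewrite (is_unit_unary ugh hs).
- move=> G D r1 r2 h1 h2.
  rewrite (graft_unary h1 hl hh) (graft_unary h2 hl hh) => e12.
  apply: (lu G D) => //.
  have k1 := hom2_graft h1 hl; have k2 := hom2_graft h2 hl.
  rewrite -(is_unit_unary uhg k1) -(is_unit_unary uhg k2).
  by rewrite (unary_unary k1 hh hg) (unary_unary k2 hh hg) e12.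
Qed.

Hypothesis hX : unital X.

(** For cells [(i, u) -> (u)] with [i] a unit the two universalities imply each
    other, although the cell need not be the unitor [l]: it differs from [l] by
    an endomorphism [h] of [u], and either universality makes [h]
    invertible. *)
Lemma unit_out_inp l lam i u :
  out_univ l [:: i; u] u -> inp_univ l i u u ->
  out_univ lam [:: i; u] u -> inp_univ lam i u u.
Proof.
move=> lo li [hm me mu]; have [hl le lu] := lo.
have [h hh eh] := le [::] [::] [:: u] lam hm; rewrite /= in eh.
have [hu hue huu] : out_univ h [:: u] u.
  by apply: (@out_cancel l [:: i; u] u h [::] [::] u); rewrite //= -?eh.
have [j uj] := hX u; have [hj _ _] := uj.
have [g hg eg] := hue [::] [::] [:: u] j hj; rewrite /= in eg.
have ej : cut 0 0 g h = j.
  apply: (huu [::] [::] [:: u]) => //=; first exact: hom2_unary hg hh.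
  rewrite (unary_unary hh hg hh) -eg (is_unit_plug (G1 := [::]) uj hh).
  by rewrite (is_unit_unary uj hh).
rewrite eh; apply: (@inverse_inp h g) => //.
by split; rewrite // -?eg ?ej.
Qed.

Lemma unit_inp_out l lam i u :
  out_univ l [:: i; u] u -> inp_univ l i u u ->
  inp_univ lam i u u -> out_univ lam [:: i; u] u.
Proof.
move=> lo li [hm me mu]; have [hl le lu] := lo; have [_ lie liu] := li.
have [h hh eh] := le [::] [::] [:: u] lam hm; rewrite /= in eh.
have [j uj] := hX u; have [hj _ _] := uj.
have [//|r hr er] := me [:: u] [::] l _ hl.
have [g hg eg] := le [::] [::] [:: u] (cut 0 1 r l) (hom2_graft hr hl).
rewrite /= in hg eg.
have ej : cut 0 0 g h = j.
  apply: (lu [::] [::] [:: u]) => //=; first exact: hom2_unary hg hh.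
  rewrite (unary_unary hl hg hh) -eg -(graft_unary hr hl hh) -eh -er.
  by rewrite (is_unit_unary uj hl).
have ej' : cut 0 0 h g = j.
  (* [h g h = h] gives [h g = 1] once [h] can be cancelled on the right. The
     part [l k] of [l k h] is [l] grafted onto some [k'], so that [l k h] is
     [lam] grafted onto [k'], which determines [k'], hence [k]. *)
  have hhg := hom2_unary hh hg.
  have canc k : hom2 k [:: u] [:: u] -> exists2 k', hom2 k' [:: u] [:: u] &
      cut 0 0 l k = cut 0 1 k' l /\ cut 0 0 l (cut 0 0 k h) = cut 0 1 k' lam.
    move=> hk; have [//|k' hk' ek] := lie [:: u] [::] (cut 0 0 l k) _ (hom2_unary hl hk).
    exists k' => //; split=> //.
    by rewrite (unary_unary hl hk hh) ek eh (graft_unary hk' hl hh).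
  have [k1 hk1 [ek1 ek1']] := canc _ hhg; have [k2 hk2 [ek2 ek2']] := canc _ hj.
  apply: (lu [::] [::] [:: u]) => //=; rewrite ek1 ek2; congr (cut _ _ _ _).
  apply: (mu [:: u] [::]) => //; rewrite -ek1' -ek2'.
  rewrite -(unary_unary hh hg hh) ej (is_unit_unary uj hh).
  by rewrite (is_unit_plug (G1 := [::]) uj hh).
rewrite eh; apply: (@out_comp l [:: i; u] u h [::] [::] u) => //.
by apply: (@inverse_out h g); split; rewrite ?ej ?ej'.
Qed.

(** * Zigzags *)

(** In this part [n : (e, u) -> (a)] and [w : (e', a) -> (u)] have composites
    that factor through [t : (e, e') -> (i)] and [t' : (e', e) -> (i')]. The
    situation is symmetric under exchanging [(e, n, t', lam')] with
    [(e', w, t, lam)], and each lemma is used both ways. *)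

Lemma zigzag_inp n e u a w e' t' i' lam' r G D :
  hom2 n [:: e; u] [:: a] -> hom2 w [:: e'; a] [:: u] ->
  hom2 t' [:: e'; e] [:: i'] -> hom2 lam' [:: i'; u] [:: u] ->
  cut 0 1 n w = cut 0 0 t' lam' -> hom2 r G (u :: D) ->
  cut 0 1 (cut 0 1 r n) w = cut 0 0 t' (cut 0 1 r lam').
Proof.
move=> hn hw ht hl e0 hr.
by rewrite -(graft_graft hr hn hw) e0 (graft_plug ht hr hl).
Qed.

Lemma zigzag_out n e u a w e' t i lam r G1 G2 D :
  hom2 n [:: e; u] [:: a] -> hom2 w [:: e'; a] [:: u] ->
  hom2 t [:: e; e'] [:: i] -> hom2 lam [:: i; a] [:: a] ->
  cut 0 1 w n = cut 0 0 t lam -> hom2 r (G1 ++ a :: G2) D ->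
  cut 0 (size G1).+1 w (cut 0 (size G1) n r) =
  cut 0 (size G1) t (cut 0 (size G1) lam r).
Proof.
move=> hn hw ht hl e0 hr.
have := plug_plug (G1 := [:: e]) (G2 := [::]) hw hn hr; rewrite addn1 => ->.
have := plug_plug (G1 := [::]) (G2 := [:: a]) ht hl hr; rewrite addn0 => ->.
by rewrite -e0.
Qed.

Lemma zigzag_inp_unique n e u a w e' t' i' lam' :
  hom2 n [:: e; u] [:: a] -> hom2 w [:: e'; a] [:: u] ->
  out_univ t' [:: e'; e] i' -> inp_univ lam' i' u u ->
  cut 0 1 n w = cut 0 0 t' lam' -> inp_unique u n.
Proof.
move=> hn hw [ht _ tu] [hl _ lu] e0 G D r1 r2 h1 h2 e12.
apply: (lu G D) => //; apply: (tu [::] G (u :: D)); [exact: hom2_graft h1 hl|exact: hom2_graft h2 hl|].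
by rewrite /= -(zigzag_inp hn hw ht hl e0 h1) -(zigzag_inp hn hw ht hl e0 h2) e12.
Qed.

Lemma zigzag_out_unique n e u a w e' t i lam :
  hom2 n [:: e; u] [:: a] -> hom2 w [:: e'; a] [:: u] ->
  out_univ t [:: e; e'] i -> out_univ lam [:: i; a] a ->
  cut 0 1 w n = cut 0 0 t lam -> out_unique a n.
Proof.
move=> hn hw [ht _ tu] [hl _ lu] e0 G1 G2 D r1 r2 h1 h2 e12.
apply: (lu G1 G2 D) => //; apply: (tu G1 (a :: G2) D).
- exact: hom2_plug hl h1.
- exact: hom2_plug hl h2.
by rewrite -(zigzag_out hn hw ht hl e0 h1) -(zigzag_out hn hw ht hl e0 h2) e12.
Qed.

(** Grafting [w] onto [s] gives the same as grafting [n] and then [w] onto some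
    [r]; cancelling [w] leaves [s] as [n] grafted onto [r]. Cancelling [w] is
    where the zigzag with the roles of [n] and [w] exchanged comes in. *)
Lemma zigzag_inp_exists n e u a w e' t' i' lam' t i lam :
  hom2 n [:: e; u] [:: a] -> hom2 w [:: e'; a] [:: u] ->
  out_univ t [:: e; e'] i -> inp_univ lam i a a ->
  out_univ t' [:: e'; e] i' -> inp_exists i' u u lam' ->
  hom2 lam' [:: i'; u] [:: u] ->
  cut 0 1 w n = cut 0 0 t lam -> cut 0 1 n w = cut 0 0 t' lam' ->
  inp_exists e u a n.
Proof.
move=> hn hw to li [ht' te' _] le hl e1 e2 G D s hG hs.
have [q hq eq] := te' [::] G (u :: D) (cut 0 1 s w) (hom2_graft hs hw).
have [r hr er] := le G D q hG hq.
exists r => //.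
apply: (zigzag_inp_unique hw hn to li e1) hs (hom2_graft hr hn) _.
by rewrite eq er (zigzag_inp hn hw ht' hl e2 hr).
Qed.

Lemma zigzag_univ n e u a w e' t' i' lam' t i lam :
  hom2 n [:: e; u] [:: a] -> hom2 w [:: e'; a] [:: u] ->
  out_univ t [:: e; e'] i -> out_univ lam [:: i; a] a -> inp_univ lam i a a ->
  out_univ t' [:: e'; e] i' -> out_univ lam' [:: i'; u] u -> inp_univ lam' i' u u ->
  cut 0 1 w n = cut 0 0 t lam -> cut 0 1 n w = cut 0 0 t' lam' ->
  out_univ n [:: e; u] a /\ inp_univ n e u a.
Proof.
move=> hn hw to lo li to' lo' li' e1 e2; split; split=> //.
- move=> G1 G2 D s hs.
  have [ht te tu] := to; have [hl le lu] := lo.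
  have hws : hom2 (cut 0 (size G1).+1 w s) (G1 ++ [:: e; e'] ++ a :: G2) D.
    have hs' : hom2 s ((G1 ++ [:: e]) ++ u :: G2) D by move: hs; rewrite -catA.
    by move: (hom2_plug hw hs'); rewrite size_cat addn1 -!catA.
  have [q hq eq] := te _ _ _ _ hws; have [r hr er] := le _ _ _ _ hq.
  exists r => //.
  apply: (zigzag_out_unique hw hn to' lo' e2 (G1 := G1 ++ [:: e]) (G2 := G2) (D := D)).
  + by move: hs; rewrite -catA.
  + by move: (hom2_plug hn hr); rewrite -catA.
  by rewrite size_cat addn1 eq er (zigzag_out hn hw ht hl e1 hr).
- exact: zigzag_out_unique hn hw to lo e1.
- by have [hl le _] := li'; exact: zigzag_inp_exists hn hw to li to' le hl e1 e2.
- exact: zigzag_inp_unique hn hw to' li' e2.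
Qed.

End Whiskering.

(** * Weakly invertible 1-cells are tensor universal *)

Section WeakInverse.
Variable X : polybicategory.
Implicit Types (a b c d e u v i : cell1 X) (t s r n w p q : cell2 X).
Implicit Types (x y z : cell0 X) (T G D E F : seq (cell1 X)).

Definition weak_inverse e e' := exists i i' t t',
  [/\ hom1 e' (tgt e) (src e), tensor_unit (src e) i, tensor_unit (tgt e) i',
      out_univ t [:: e; e'] i & out_univ t' [:: e'; e] i'].

Lemma weak_inverse_sym e e' : weak_inverse e e' -> weak_inverse e' e.
Proof.
move=> [i [i' [t [t' [[h1 h2] ui ui' ht ht']]]]].
by exists i', i, t', t; rewrite h1 h2.
Qed.

Lemma tensor_unit_left x i a : tensor_unit x i -> src a = x ->
  exists l, out_univ l [:: i; a] a /\ inp_univ l i a a.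
Proof.
move=> [_ U _] sa; have [//|l [hl lo li]] := U (tgt a) a.
by exists l; split; [apply/universal_outP|apply/universal_inp1P].
Qed.

Hypothesis hX : unital X.

(** With tensors: [n] and the composites are universal on the output side by
    cancellation, so [lam'] is, and the unit cells do the rest. *)
Lemma zigzag_of_tensor e e' a u w :
  weak_inverse e e' -> src a = src e -> out_univ w [:: e'; a] u ->
  exists n, [/\ out_univ n [:: e; u] a, inp_univ n e u a & inp_univ w e' a u].
Proof.
move=> [i [i' [t [t' [[se' te'] ui ui' to to']]]]] sa wo.
have [hw we _] := wo; have [ht _ _] := to; have [ht' t'e _] := to'.
have [l [lo li]] := tensor_unit_left ui sa.
have su : src u = tgt e by rewrite -(hom2_src hw).
have [l' [lo' li']] := tensor_unit_left ui' su.
have tlo : out_univ (cut 0 0 t l) [:: e; e'; a] a.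
  exact: (@out_comp _ t [:: e; e'] i l [::] [:: a] a).
have [htl _ _] := tlo.
have [n hn en] := we [:: e] [::] [:: a] _ htl; rewrite /= in hn en.
have no : out_univ n [:: e; u] a.
  by apply: (@out_cancel _ w [:: e'; a] u n [:: e] [::] a); rewrite //= -en.
have nwo : out_univ (cut 0 1 n w) [:: e'; e; u] u.
  exact: (@out_comp _ n [:: e; u] a w [:: e'] [::] u).
have [hnw _ _] := nwo.
have [m hm em] := t'e [::] [:: u] [:: u] _ hnw; rewrite /= in hm em.
have mo : out_univ m [:: i'; u] u.
  by apply: (@out_cancel _ t' [:: e'; e] i' m [::] [:: u] u); rewrite //= -em.
have mi := unit_out_inp hX lo' li' mo.
have [_ ni] := zigzag_univ hn hw to lo li to' mo mi (esym en) em.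
have [_ wi] := zigzag_univ hw hn to' mo mi to lo li em (esym en).
by exists n.
Qed.

(** With homs: here [w] and [lam'] are first shown to be universal on the input
    side, by two-out-of-three arguments for repeated whiskering. *)
Lemma zigzag_of_hom e e' a u n :
  weak_inverse e e' -> src a = src e -> inp_univ n e u a ->
  exists w, [/\ out_univ n [:: e; u] a, out_univ w [:: e'; a] u & inp_univ w e' a u].
Proof.
move=> [i [i' [t [t' [[se' te'] ui ui' to to']]]]] sa ni.
have [hn ne nu] := ni; have [ht te tu] := to; have [ht' t'e t'u] := to'.
have [l [lo li]] := tensor_unit_left ui sa; have [hl le lu] := li.
have su : src u = tgt e by rewrite -(hom2_adj (G := [::]) hn).
have [l' [lo' li']] := tensor_unit_left ui' su.
have htl : hom2 (cut 0 0 t l) [:: e; e'; a] [:: a].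
  exact: (hom2_plug (G1 := [::]) (G2 := [:: a]) ht hl).
have [//|w hw ew] := ne [:: e'; a] [::] _ _ htl.
have wi : inp_univ w e' a u.
  split=> //; last exact: zigzag_inp_unique hw hn to li (esym ew).
  move=> G D s hG hs.
  have [q hq eq] := te [::] G (a :: D) (cut 0 1 s n) (hom2_graft hs hn).
  have [r hr er] := le G D q hG hq.
  exists r => //; apply: (nu _ D _ _ hs (hom2_graft hr hw)).
  by rewrite eq er (zigzag_inp hw hn ht hl (esym ew) hr).
have [_ we wu] := wi.
have hnw : hom2 (cut 0 1 n w) [:: e'; e; u] [:: u] := hom2_graft hn hw.
have [m hm em] := t'e [::] [:: u] [:: u] _ hnw; rewrite /= in hm em.
have mi : inp_univ m i' u u.
  split=> //.
    move=> G D s hG hs.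
    have hts := hom2_plug (G1 := [::]) (G2 := G) ht' hs.
    have [//|q hq eq] := we (e :: G) D _ _ hts.
    have [r hr er] := ne G D q hG hq.
    exists r => //; apply: (t'u [::] G (u :: D)) => //; first exact: hom2_graft hr hm.
    by rewrite /= in eq *; rewrite eq er (zigzag_inp hn hw ht' hm em hr).
  move=> G D r1 r2 h1 h2 e12; apply: (nu _ D _ _ h1 h2).
  apply: (wu (e :: G) D); [exact: hom2_graft h1 hn|exact: hom2_graft h2 hn|].
  by rewrite (zigzag_inp hn hw ht' hm em h1) (zigzag_inp hn hw ht' hm em h2) e12.
have mo := unit_inp_out hX lo' li' mi.
have [no _] := zigzag_univ hn hw to lo li to' mo mi (esym ew) em.
have [wo _] := zigzag_univ hw hn to' mo mi to lo li em (esym ew).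
by exists w.
Qed.

Lemma zigzag_exists e e' a y :
  tensor_1_representable X \/ right_1_closed X ->
  weak_inverse e e' -> hom1 a (src e) y ->
  exists u n w, hom1 u (tgt e) y /\
    [/\ out_univ n [:: e; u] a, inp_univ n e u a,
        out_univ w [:: e'; a] u & inp_univ w e' a u].
Proof.
move=> hrep inv [sa ta]; have [i [i' [t [t' [[se' te'] _ _ _ _]]]]] := inv.
suff [u [n [w U]]] : exists u n w, [/\ out_univ n [:: e; u] a, inp_univ n e u a,
        out_univ w [:: e'; a] u & inp_univ w e' a u].
  exists u, n, w; split=> //; case: U => -[hn _ _] _ _ _.
  split; first by rewrite (hom2_adj (G := [::]) hn).
  by rewrite (hom2_tgt (G := [:: e]) (D := [::]) hn).
case: hrep => -[_ H].
  have [//|//|u [w [hw wo]]] := H (tgt e) (src e) y e' a.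
  have {}wo := (universal_outP hw).1 wo.
  by have [n [no ni wi]] := zigzag_of_tensor inv sa wo; exists u, n, w.
have [//|//|u [n [_ hn ni]]] := H (src e) (tgt e) y e a.
have {}ni := (universal_inp1P hn).1 ni.
by have [w [no wo wi]] := zigzag_of_hom inv sa ni; exists u, n, w.
Qed.

(** The 1-cells [v] with [(e, a) -> (v)] are found in the zigzag of the weak
    inverse [e'], as its second half. *)
Lemma weak_inverse_left_universal e e' :
  tensor_1_representable X \/ right_1_closed X ->
  weak_inverse e e' -> tensor_left_universal e.
Proof.
move=> hrep inv; split=> y a ha.
  have [u [n [w [hu [no ni _ _]]]]] := zigzag_exists hrep inv ha.
  have [hn _ _] := no; exists u, n; split=> //; first exact/(universal_outP hn).
  exact/(universal_inp1P hn).
have [i [i' [t [t' [[se' te'] _ _ _ _]]]]] := inv.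
rewrite -se' in ha.
have [v [n [w [hv [_ _ wo wi]]]]] := zigzag_exists hrep (weak_inverse_sym inv) ha.
rewrite te' in hv.
have [hw _ _] := wo; exists v, w; split=> //; first exact/(universal_outP hw).
exact/(universal_inp1P hw).
Qed.

End WeakInverse.

(** * Tensor universal 1-cells are weakly invertible *)

Section TensorUniversal.
Variable X : polybicategory.
Implicit Types (a b c d e u v i : cell1 X) (t s r n w p q l : cell2 X).
Implicit Types (x y z : cell0 X) (T G D E F : seq (cell1 X)).

Lemma tensor_left_from e y a : tensor_universal e -> hom1 a (src e) y ->
  exists u n, [/\ hom1 u (tgt e) y, out_univ n [:: e; u] a & inp_univ n e u a].
Proof.
case=> -[H _] _ /H[u [n [hu hn no ni]]]; exists u, n.
by split=> //; [exact/universal_outP|exact/universal_inp1P].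
Qed.

Lemma tensor_left_to e a : tensor_universal e -> src a = tgt e ->
  exists v q, out_univ q [:: e; a] v /\ inp_univ q e a v.
Proof.
move=> [[_ H] _] sa; have [//|v [q [_ hq qo qi]]] := H (tgt a) a.
by exists v, q; split; [exact/universal_outP|exact/universal_inp1P].
Qed.

Lemma tensor_right_from e b : tensor_universal e -> tgt b = tgt e ->
  exists u q, out_univ q [:: u; e] b /\ universal_inp 0 q.
Proof.
move=> [_ [H _]] tb; have [//|u [q [_ hq qo qi]]] := H (src b) b.
by exists u, q; split=> //; exact/universal_outP.
Qed.

Lemma plug_swap t1 T a t2 b1 b2 d s F1 F3 D :
  hom2 t1 T [:: a] -> hom2 t2 [:: b1; b2] [:: d] ->
  hom2 s (F1 ++ a :: d :: F3) D ->
  cut 0 (size F1 + size T) t2 (cut 0 (size F1) t1 s) =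
  cut 0 (size F1) t1 (cut 0 (size F1).+1 t2 s).
Proof.
move=> h1 h2 hs.
have := @cut_interchange _ _ _ _ _ [::] a _ d [::] F1 [::] F3 _ h1 h2 hs.
by rewrite addn0 addn1; apply; right.
Qed.

(** A 1-cell [g] preceding [b1] can be divided by [e], so that [e] comes to stand
    before [b1]; when nothing precedes [b1], tensoring [e] with the first output
    puts [e] there. Both changes are bijective on cells and commute with
    plugging [t]. *)
Lemma out_univ_bend e t b1 b2 c : tensor_universal e ->
  hom2 t [:: b1; b2] [:: c] -> src b1 = tgt e ->
  (forall G1 G2 D s, hom2 s (G1 ++ e :: b1 :: b2 :: G2) D ->
    exists2 r, hom2 r (G1 ++ e :: c :: G2) D & s = cut 0 (size G1).+1 t r) ->
  (forall G1 G2 D r1 r2, hom2 r1 (G1 ++ e :: c :: G2) D ->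
    hom2 r2 (G1 ++ e :: c :: G2) D ->
    cut 0 (size G1).+1 t r1 = cut 0 (size G1).+1 t r2 -> r1 = r2) ->
  out_univ t [:: b1; b2] c.
Proof.
move=> ue ht sb ex un; have sc : src c = tgt e by rewrite -(hom2_src ht).
split=> //.
  move=> G1 G2 D s; case/lastP: G1 => [|G1 g] hs.
    case: D hs => [/hom2_out_neq_nil//|d D hs].
    have sd : src d = tgt e by rewrite -(hom2_src hs).
    have [v [q [[hq _ _] [_ qe qu]]]] := tensor_left_to ue sd.
    have [r' hr' er'] := ex [::] G2 _ _ (hom2_graft hs hq).
    have [//|r hr er] := qe (c :: G2) D r' _ hr'.
    exists r => //; apply: (qu (b1 :: b2 :: G2) D _ _ hs).
      exact: (hom2_plug (G1 := [::]) ht hr).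
    by rewrite er' er /= -(plug_graft (G1 := [::]) ht hr hq).
  rewrite cat_rcons in hs.
  have tg : tgt g = tgt e by rewrite (hom2_adj hs).
  have [u [q [[hq qe qu] _]]] := tensor_right_from ue tg.
  have hqs : hom2 (cut 0 (size G1) q s) ((G1 ++ [:: u]) ++ e :: b1 :: b2 :: G2) D.
    by rewrite -catA; exact: hom2_plug hq hs.
  have [r' hr' er'] := ex _ _ _ _ hqs; rewrite -catA in hr'.
  have [r hr er] := qe G1 (c :: G2) D r' hr'.
  have hr2 : hom2 r (rcons G1 g ++ c :: G2) D by rewrite cat_rcons.
  exists r => //; apply: (qu G1 (b1 :: b2 :: G2) D) => //.
    by move: (hom2_plug ht hr2); rewrite cat_rcons.
  rewrite er' er size_cat size_rcons /= addn1.
  by rewrite -(plug_swap hq ht hr) /= addn2.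
move=> G1 G2 D r1 r2; case/lastP: G1 => [|G1 g] h1 h2 e12.
  case: D h1 h2 => [/hom2_out_neq_nil//|d D h1 h2].
  have sd : src d = tgt e by rewrite -(hom2_src h1).
  have [v [q [[hq _ _] [_ qe qu]]]] := tensor_left_to ue sd.
  apply: (qu (c :: G2) D _ _ h1 h2).
  apply: (un [::] G2 (v :: D)) => /=; [exact: hom2_graft h1 hq|exact: hom2_graft h2 hq|].
  by rewrite (plug_graft (G1 := [::]) ht h1 hq) (plug_graft (G1 := [::]) ht h2 hq) e12.
rewrite cat_rcons in h1 h2.
have tg : tgt g = tgt e by rewrite (hom2_adj h1).
have [u [q [[hq qe qu] _]]] := tensor_right_from ue tg.
apply: (qu G1 (c :: G2) D) => //; apply: (un (G1 ++ [:: u]) G2 D).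
- by rewrite -catA; exact: hom2_plug hq h1.
- by rewrite -catA; exact: hom2_plug hq h2.
move: e12; rewrite size_cat size_rcons /= addn1 => e12.
have := plug_swap hq ht h1; have := plug_swap hq ht h2.
by rewrite /= addn2 e12 => -> ->.
Qed.

Section Unit.
Variables (e i : cell1 X) (p : cell2 X).
Hypotheses (ue : tensor_universal e) (po : out_univ p [:: e; i] e).

(** The cell [s] factors through [q], and both sides plug the same composite
    [(e, i, a) -> (v)] into the other factor. *)
Lemma unit_triangle a v q l s G1 G2 D :
  hom2 l [:: i; a] [:: a] -> out_univ q [:: e; a] v ->
  cut 0 1 l q = cut 0 0 p q ->
  hom2 s (G1 ++ e :: a :: G2) D ->
  cut 0 (size G1).+1 l s = cut 0 (size G1) p s.
Proof.
move=> hl [hq qe _] elq hs; have [hp _ _] := po.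
have [r hr ->] := qe G1 G2 D s hs.
have := plug_plug (G1 := [:: e]) (G2 := [::]) hl hq hr; rewrite addn1 => ->.
have := plug_plug (G1 := [::]) (G2 := [:: a]) hp hq hr; rewrite addn0 => ->.
by rewrite elq.
Qed.

Lemma left_unitor a : src a = tgt e ->
  exists l, out_univ l [:: i; a] a /\ inp_univ l i a a.
Proof.
move=> sa; have [hp pe pu] := po.
have [v [q [qo qi]]] := tensor_left_to ue sa.
have [hq _ _] := qo; have [_ qie qiu] := qi.
have [//|l hl el] := qie [:: i; a] [::] _ _ (hom2_plug (G1 := [::]) (G2 := [:: a]) hp hq).
have tri s G1 G2 D : hom2 s (G1 ++ e :: a :: G2) D ->
    cut 0 (size G1).+1 l s = cut 0 (size G1) p s.
  exact: unit_triangle hl qo (esym el).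
have si : src i = tgt e by rewrite -(hom2_adj (G := [::]) hp).
exists l; split.
  apply: out_univ_bend ue hl si _ _.
    move=> G1 G2 D s hs; have [r hr er] := pe G1 (a :: G2) D s hs.
    by exists r => //; rewrite (tri _ _ _ _ hr).
  move=> G1 G2 D r1 r2 h1 h2; rewrite (tri _ _ _ _ h1) (tri _ _ _ _ h2).
  exact: pu h1 h2.
have gl r G D : hom2 r G (a :: D) ->
    cut 0 1 (cut 0 1 r l) q = cut 0 0 p (cut 0 1 r q).
  by move=> hr; rewrite -(graft_graft hr hl hq) -el (graft_plug hp hr hq).
split=> //.
  move=> G D s hG hs.
  have [s' hs' es'] := pe [::] G (v :: D) _ (hom2_graft hs hq).
  have [r hr er] := qie G D s' hG hs'.
  exists r => //; apply: (qiu (i :: G) D _ _ hs (hom2_graft hr hl)).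
  by rewrite (gl _ _ _ hr) es' er.
move=> G D r1 r2 h1 h2 e12; apply: (qiu G D _ _ h1 h2).
apply: (pu [::] G (v :: D)); [exact: hom2_graft h1 hq|exact: hom2_graft h2 hq|].
by rewrite /= -(gl _ _ _ h1) -(gl _ _ _ h2) e12.
Qed.

(** Input universality is checked after dividing the last 1-cell [g] of [G] by
    [e]: there plugging [p] is bijective, and [key] identifies cutting with [m]
    as plugging [p]. *)
Lemma right_unitor b : tgt b = tgt e ->
  exists r, [/\ hom2 r [:: b; i] [:: b], universal_out 0 r & universal_inp 0 r].
Proof.
move=> tb; have [hp pe pu] := po.
have [u [q [qo qi]]] := tensor_right_from ue tb.
have [hq qe qu] := qo; have [qie qiu] := (universal_inp0P hq).1 qi.
have pqo : out_univ (cut 0 1 p q) [:: u; e; i] b.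
  exact: (@out_comp _ p [:: e; i] e q [:: u] [::] b).
have [hpq _ _] := pqo.
have [m hm em] := qe [::] [:: i] [:: b] _ hpq; rewrite /= in hm em.
have mo : out_univ m [:: b; i] b.
  by apply: (@out_cancel _ q [:: u; e] b m [::] [:: i] b); rewrite //= -em.
exists m; split=> //; first exact/(universal_outP hm).
have key G (g : cell1 X) D c (k r : cell2 X) : hom2 k [:: c; e] [:: g] ->
    hom2 r (G ++ [:: g]) (D ++ [:: b]) ->
    cut 0 (size G) k (cut (size D) 0 r m) =
    cut 0 (size G).+1 p (cut 0 (size G) k r).
  move=> hk hr.
  have hkr := hom2_plug hk hr.
  have := @cut_assoc _ k r m _ [::] g [::] G [::] D b [::] [::] [:: i] _ hk hr hm.
  rewrite !add0n => -> //; try by [left|right].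
  have [||r' hr' er'] := qie (G ++ [:: c]) D (cut 0 (size G) k r).
    by case: (G).
    by rewrite -catA; exact: hkr.
  rewrite er'.
  have := @cut_assoc _ r' q m _ D u [::] [::] [:: e] [::] b [::] [::] [:: i] _ hr' hq hm.
  rewrite /= !addn0 => <- //; try by [left|right].
  rewrite -em.
  have := @cut_interchange _ r' p q _ D u _ e [::] [::] [::] [::] _ hr' hp hq.
  by rewrite /= size_cat /= addn1 add0n addn0 => -> //; [left|right].
have split_last G D s : G <> [::] -> hom2 s (G ++ [:: i]) D ->
    exists G1 (g c : cell1 X) k, [/\ G = G1 ++ [:: g], out_univ k [:: c; e] g & tgt g = tgt e].
  case/lastP: G => // G' g _; rewrite cat_rcons => hs.
  have tg : tgt g = tgt e.
    by rewrite (hom2_adj hs) -(hom2_adj (G := [::]) hp).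
  have [w [k [ko _]]] := tensor_right_from ue tg.
  by exists G', g, w, k; rewrite cats1.
apply/(universal_inp0P hm); split.
  move=> G D s hG hs.
  have [G' [g [w [k [eG [hk ke ku] _]]]]] := split_last _ _ _ hG hs; subst G.
  rewrite -catA in hs.
  have hks : hom2 (cut 0 (size G') k s) ((G' ++ [:: w]) ++ [:: e; i]) (D ++ [:: b]).
    by rewrite -catA; exact: hom2_plug hk hs.
  have [s' hs' es'] := pe _ [::] _ _ hks; rewrite -catA in hs'.
  have [r hr er] := ke G' [::] _ s' hs'.
  exists r => //; apply: (ku G' [:: i] (D ++ [:: b])) => //.
    have := hom2_cut (D2 := [::]) (G1 := [::]) hr hm (or_introl erefl) (or_intror erefl).
    by rewrite /= -catA.
  by rewrite (key _ _ _ _ _ _ hk hr) es' er size_cat addn1.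
move=> G D r1 r2 h1 h2 e12.
have hs := hom2_cut (D2 := [::]) (G1 := [::]) h1 hm (or_introl erefl) (or_intror erefl).
have [G' [g [w [k [eG [hk ke ku] _]]]]] := split_last _ _ _ (hom2_inp_neq_nil h1) hs.
subst G; apply: (ku G' [::] (D ++ [:: b])) => //.
apply: (pu (G' ++ [:: w]) [::] (D ++ [:: b])).
- by rewrite -catA; exact: hom2_plug hk h1.
- by rewrite -catA; exact: hom2_plug hk h2.
by rewrite size_cat /= addn1 -(key _ _ _ _ _ _ hk h1) -(key _ _ _ _ _ _ hk h2) e12.
Qed.

Lemma tensor_unit_tgt : hom1 i (tgt e) (tgt e) -> tensor_unit (tgt e) i.
Proof.
move=> hi; split=> // [y a [sa _]|z b [_ tb]]; last exact: right_unitor.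
have [l [lo li]] := left_unitor sa; have [hl _ _] := lo.
by exists l; split=> //; [exact/(universal_outP hl)|exact/(universal_inp1P hl)].
Qed.

End Unit.

Lemma tensor_universal_unit e : tensor_universal e ->
  exists i p, [/\ tensor_unit (tgt e) i, out_univ p [:: e; i] e & inp_univ p e i e].
Proof.
move=> ue; have [i [p [hi po pi]]] := tensor_left_from ue (conj (erefl (src e)) (erefl (tgt e))).
by exists i, p; split=> //; apply: tensor_unit_tgt po hi.
Qed.

(** Plugging [t'] and then [p] amounts to plugging [(e, e', e) -> (i, e) -> (e)];
    since the latter and [p] are universal, [t'] is universal in contexts with
    [e] on its left, and bending applies. *)
Lemma tensor_universal_weak_inverse e i : tensor_universal e ->
  tensor_unit (src e) i -> exists e', weak_inverse e e'.
Proof.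
move=> ue ui; have [hi _ _] := ui.
have [e' [t [he' to _]]] := tensor_left_from ue hi.
have [i' [p [ui' po pi]]] := tensor_universal_unit ue.
have [l [lo _]] := tensor_unit_left ui (erefl (src e)).
have [hp pe pu] := po; have [_ pie piu] := pi; have [hl _ _] := lo.
have tlo : out_univ (cut 0 0 t l) [:: e; e'; e] e.
  exact: (@out_comp _ t [:: e; e'] i l [::] [:: e] e).
have [htl tle tlu] := tlo.
have [//|t' ht' et'] := pie [:: e'; e] [::] _ _ htl.
exists e', i, i', t, t'; split=> //.
have key G1 G2 D r : hom2 r (G1 ++ e :: G2) D ->
    cut 0 (size G1).+1 t' (cut 0 (size G1) p r) = cut 0 (size G1) (cut 0 0 t l) r.
  move=> hr; have := plug_plug (G1 := [:: e]) (G2 := [::]) ht' hp hr.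
  by rewrite addn1 => ->; rewrite -et'.
case: he' => se' _.
apply: out_univ_bend ue ht' se' _ _.
  move=> G1 G2 D s hs; have [r hr er] := tle G1 G2 D s hs.
  exists (cut 0 (size G1) p r); first exact: hom2_plug hp hr.
  by rewrite (key _ _ _ _ hr).
move=> G1 G2 D r1 r2 h1 h2 e12.
have [r1' h1' er1] := pe G1 G2 D r1 h1; have [r2' h2' er2] := pe G1 G2 D r2 h2.
rewrite er1 er2 (key _ _ _ _ h1') (key _ _ _ _ h2') in e12 *.
by rewrite (tlu _ _ _ _ _ h1' h2' e12).
Qed.

End TensorUniversal.

(** * The mirror image *)

Section Mirror.
Variable X : polybicategory.

Lemma rev_neq_nil (A : Type) (s : seq A) : s <> [::] -> rev s <> [::].
Proof. by case: s => // a s _ /(congr1 size); rewrite size_rev. Qed.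

Lemma rev_eq_nil (A : Type) (s : seq A) : rev s = [::] <-> s = [::].
Proof. by split=> [/(congr1 size)|->//]; rewrite size_rev; case: s. Qed.

Lemma chain_rev (C0 C1 : Type) (src tgt : C1 -> C0) x s y :
  chain src tgt x s y -> chain tgt src y (rev s) x.
Proof.
have chain_rcons z s' a y' : chain tgt src z s' (tgt a) -> src a = y' ->
    chain tgt src z (rcons s' a) y'.
  by elim: s' z => [|b s' IH] z /=; [move=> ->|case=> -> /IH h /h].
elim: s x => [|a s IH] x /=; first by move=> ->.
by case=> sa /IH h; rewrite rev_cons; exact: chain_rcons.
Qed.

(** Reversing inputs and outputs and exchanging sources with targets turns right
    universality into left universality. Inputs and outputs keep their roles,
    so the two cuts in [cut_inpC] and [cut_outC] trade places: the first
    position becomes the last. *)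
Definition mirror_graph : polygraph.
refine (@Polygraph (cell0 X) (cell1 X) (cell2 X) (@tgt X) (@src X)
  (fun t => rev (inp t)) (fun t => rev (out t)) _ _ _).
- by move=> t; exact/rev_neq_nil/inp_neq_nil.
- by move=> t; exact/rev_neq_nil/out_neq_nil.
- move=> t; have [x [y [hi ho]]] := inp_out_parallel t.
  by exists y, x; split; exact: chain_rev.
Defined.

Definition mirror_cut (j i : nat) (t s : cell2 mirror_graph) : cell2 mirror_graph :=
  cut (size (@out X t) - j.+1) (size (@inp X s) - i.+1) t s.

Lemma rev_mid (A : Type) (s s1 s2 : seq A) a :
  rev s = s1 ++ a :: s2 -> s = rev s2 ++ a :: rev s1.
Proof. by move=> e; rewrite -[s]revK e rev_cat rev_cons cat_rcons. Qed.

Lemma mirror_cuttable j i (t s : cell2 X) :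
  @cuttable mirror_graph j i t s ->
  [/\ @cuttable X (size (out t) - j.+1) (size (inp s) - i.+1) t s,
      j < size (@out X t) & i < size (@inp X s)].
Proof.
case=> D1 D2 G1 G2 a ot <- is_ <- c1 c2.
have {}ot := rev_mid ot; have {}is_ := rev_mid is_.
split; last 2 first.
- by rewrite ot size_cat /= !size_rev; lia.
- by rewrite is_ size_cat /= !size_rev; lia.
apply: (@Cuttable X _ _ t s _ _ _ _ a ot _ is_).
- by rewrite ot size_cat /= !size_rev; lia.
- by rewrite is_ size_cat /= !size_rev; lia.
- by rewrite !rev_eq_nil.
- by rewrite !rev_eq_nil.
Qed.

Lemma size_cut j i (t s : cell2 X) : cuttable j i t s ->
  size (inp (cut j i t s)) = (size (inp t) + size (inp s)).-1 /\
  size (out (cut j i t s)) = (size (out t) + size (out s)).-1.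
Proof.
case=> D1 D2 G1 G2 a ot <- is_ <- c1 c2.
have [-> ->] := cut_boundary ot is_ c1 c2.
by rewrite ot is_ !size_cat /=; split; lia.
Qed.

Lemma mirror_cut_boundary (t s : cell2 mirror_graph)
    (D1 D2 G1 G2 : seq (cell1 mirror_graph)) (a : cell1 mirror_graph) :
  out t = D1 ++ a :: D2 -> inp s = G1 ++ a :: G2 ->
  G1 = [::] \/ D1 = [::] -> G2 = [::] \/ D2 = [::] ->
  hom2 (mirror_cut (size D1) (size G1) t s)
    (G1 ++ inp t ++ G2) (D1 ++ out s ++ D2).
Proof.
move=> ot is_ c1 c2; have {}ot := rev_mid ot; have {}is_ := rev_mid is_.
have := cut_boundary ot is_; rewrite !rev_eq_nil => /(_ c2 c1)[hi ho].
rewrite /mirror_cut ot is_ !size_cat /= !size_rev.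
have -> : size D2 + (size D1).+1 - (size D1).+1 = size D2 by lia.
have -> : size G2 + (size G1).+1 - (size G1).+1 = size G2 by lia.
rewrite !size_rev in hi ho.
by split; rewrite /= ?hi ?ho !rev_cat !revK ?catA.
Qed.

Lemma mirror_cutA (t s r : cell2 mirror_graph) (j i k l : nat) :
  cuttable j i t s -> cuttable (j + k) l (mirror_cut j i t s) r ->
  cuttable k l s r -> cuttable j (l + i) t (mirror_cut k l s r) ->
  mirror_cut j (l + i) t (mirror_cut k l s r) =
  mirror_cut (j + k) l (mirror_cut j i t s) r.
Proof.
move=> /mirror_cuttable[c1 b1 b2] /mirror_cuttable[c2 _ _].
move=> /mirror_cuttable[c3 b3 b4] /mirror_cuttable[c4 _ _].
have [s1 s2] := size_cut c1; have [s3 s4] := size_cut c3.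
move: c2 c4; rewrite /mirror_cut s2 s3.
have -> : (size (@out X t) + size (@out X s)).-1 - (j + k).+1 =
    (size (@out X t) - j.+1) + (size (@out X s) - k.+1) by lia.
have -> : (size (@inp X s) + size (@inp X r)).-1 - (l + i).+1 =
    (size (@inp X r) - l.+1) + (size (@inp X s) - i.+1) by lia.
by move=> c2 c4; exact: cutA.
Qed.

Lemma mirror_cut_inpC (t1 t2 s : cell2 mirror_graph) (j1 j2 i1 i2 : nat) :
  i1 < i2 ->
  let i2' := (i2 + size (inp t1)).-1 in
  cuttable j1 i1 t1 s -> cuttable j2 i2' t2 (mirror_cut j1 i1 t1 s) ->
  cuttable j2 i2 t2 s -> cuttable j1 i1 t1 (mirror_cut j2 i2 t2 s) ->
  mirror_cut j2 i2' t2 (mirror_cut j1 i1 t1 s) =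
  mirror_cut j1 i1 t1 (mirror_cut j2 i2 t2 s).
Proof.
move=> i12 i2'; rewrite {}/i2' /= size_rev.
move=> /mirror_cuttable[c1 b1 b2] /mirror_cuttable[c2 _ _].
move=> /mirror_cuttable[c3 b3 b4] /mirror_cuttable[c4 _ _].
have [s1 _] := size_cut c1; have [s3 _] := size_cut c3.
have lt_t1 : 0 < size (@inp X t1) by case: (@inp X t1) (@inp_neq_nil X t1) => // /(_ erefl).
have lt_t2 : 0 < size (@inp X t2) by case: (@inp X t2) (@inp_neq_nil X t2) => // /(_ erefl).
move: c2 c4; rewrite /mirror_cut s1 s3.
have -> : (size (@inp X t1) + size (@inp X s)).-1 - (i2 + size (@inp X t1)).-1.+1 =
    size (@inp X s) - i2.+1 by lia.
have -> : (size (@inp X t2) + size (@inp X s)).-1 - i1.+1 =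
    ((size (@inp X s) - i1.+1) + size (@inp X t2)).-1 by lia.
by move=> c2 c4; apply/esym/cut_inpC => //; lia.
Qed.

Lemma mirror_cut_outC (t s1 s2 : cell2 mirror_graph) (j1 j2 i1 i2 : nat) :
  j1 < j2 ->
  let j2' := (j2 + size (out s1)).-1 in
  cuttable j1 i1 t s1 -> cuttable j2' i2 (mirror_cut j1 i1 t s1) s2 ->
  cuttable j2 i2 t s2 -> cuttable j1 i1 (mirror_cut j2 i2 t s2) s1 ->
  mirror_cut j2' i2 (mirror_cut j1 i1 t s1) s2 =
  mirror_cut j1 i1 (mirror_cut j2 i2 t s2) s1.
Proof.
move=> j12 j2'; rewrite {}/j2' /= size_rev.
move=> /mirror_cuttable[c1 b1 b2] /mirror_cuttable[c2 _ _].
move=> /mirror_cuttable[c3 b3 b4] /mirror_cuttable[c4 _ _].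
have [_ e1] := size_cut c1; have [_ e3] := size_cut c3.
have lt_s1 : 0 < size (@out X s1) by case: (@out X s1) (@out_neq_nil X s1) => // /(_ erefl).
have lt_s2 : 0 < size (@out X s2) by case: (@out X s2) (@out_neq_nil X s2) => // /(_ erefl).
move: c2 c4; rewrite /mirror_cut e1 e3.
have -> : (size (@out X t) + size (@out X s1)).-1 - (j2 + size (@out X s1)).-1.+1 =
    size (@out X t) - j2.+1 by lia.
have -> : (size (@out X t) + size (@out X s2)).-1 - j1.+1 =
    ((size (@out X t) - j1.+1) + size (@out X s2)).-1 by lia.
by move=> c2 c4; apply/esym/cut_outC => //; lia.
Qed.

Definition mirror : polybicategory :=
  PolyBicategory mirror_cut_boundary mirror_cutA mirror_cut_inpC mirror_cut_outC.

Lemma mirror_hom2 (t : cell2 X) G D :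
  @hom2 mirror t (rev G) (rev D) <-> @hom2 X t G D.
Proof.
rewrite /hom2 /=; split=> [[/(congr1 rev) + /(congr1 rev)]|[-> ->]] //.
by rewrite !revK.
Qed.

Lemma mirror_cutE (t s : cell2 X) T D1 a D2 G1 G2 D :
  hom2 t T (D1 ++ a :: D2) -> hom2 s (G1 ++ a :: G2) D ->
  @cut mirror (size (rev D2)) (size (rev G2)) t s = cut (size D1) (size G1) t s.
Proof.
case=> _ ot [is_ _]; rewrite /= /mirror_cut ot is_ !size_cat !size_rev /=.
by congr (cut _ _ t s); lia.
Qed.

Lemma mirror_universal_out (t : cell2 X) D1 a D2 :
  out t = D1 ++ a :: D2 ->
  @universal_out mirror (size D2) t <-> universal_out (size D1) t.
Proof.
move=> ot; have ot' : @out mirror t = rev D2 ++ a :: rev D1.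
  by rewrite /= ot rev_cat rev_cons cat_rcons.
have E (G1 G2 D : seq (cell1 X)) (s r : cell2 X) :
    [/\ @hom2 mirror r (rev G2 ++ a :: rev G1) (rev D) &
      s = @cut mirror (size (rev D2)) (size (rev G2)) t r] <->
    (hom2 r (G1 ++ a :: G2) D /\ s = cut (size D1) (size G1) t r).
  have -> : rev G2 ++ a :: rev G1 = rev (G1 ++ a :: G2).
    by rewrite rev_cat rev_cons cat_rcons.
  rewrite mirror_hom2.
  by split=> -[hr ->]; split; rewrite // (mirror_cutE (conj erefl ot) hr).
rewrite -(size_rev D2) (universal_outE ot') (universal_outE ot).
split=> U G1 G2 D s.
  move=> c1 c2 hD hs.
  have [||||r [/E hr rP]] := U (rev G2) (rev G1) (rev D) s.
  - by rewrite !rev_eq_nil.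
  - by rewrite !rev_eq_nil.
  - by rewrite rev_eq_nil.
  - by rewrite /= -!rev_cat -!catA; apply/mirror_hom2.
  by exists r; split=> // r' /E/rP.
rewrite -[G1]revK -[G2]revK -[D]revK.
move: (rev G1) (rev G2) (rev D) => {}G2 {}G1 {}D.
rewrite !rev_eq_nil /= -!rev_cat -!catA => c1 c2 hD /mirror_hom2 hs.
have [r [hr rP]] := U G1 G2 D s c2 c1 hD hs.
by exists r; split=> [|r' /E/rP //]; apply/E.
Qed.

Lemma mirror_universal_inp (t : cell2 X) G1 a G2 :
  inp t = G1 ++ a :: G2 ->
  @universal_inp mirror (size G2) t <-> universal_inp (size G1) t.
Proof.
move=> it; have it' : @inp mirror t = rev G2 ++ a :: rev G1.
  by rewrite /= it rev_cat rev_cons cat_rcons.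
have E (D1 D2 G : seq (cell1 X)) (s r : cell2 X) :
    [/\ @hom2 mirror r (rev G) (rev D2 ++ a :: rev D1) &
      s = @cut mirror (size (rev D2)) (size (rev G2)) r t] <->
    (hom2 r G (D1 ++ a :: D2) /\ s = cut (size D1) (size G1) r t).
  have -> : rev D2 ++ a :: rev D1 = rev (D1 ++ a :: D2).
    by rewrite rev_cat rev_cons cat_rcons.
  rewrite mirror_hom2.
  by split=> -[hr ->]; split; rewrite // (mirror_cutE hr (conj it erefl)).
rewrite -(size_rev G2) (universal_inpE it') (universal_inpE it).
split=> U D1 D2 G s.
  move=> c1 c2 hG hs.
  have [||||r [/E hr rP]] := U (rev D2) (rev D1) (rev G) s.
  - by rewrite !rev_eq_nil.
  - by rewrite !rev_eq_nil.
  - by rewrite rev_eq_nil.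
  - by rewrite /= -!rev_cat -!catA; apply/mirror_hom2.
  by exists r; split=> // r' /E/rP.
rewrite -[D1]revK -[D2]revK -[G]revK.
move: (rev D1) (rev D2) (rev G) => {}D2 {}D1 {}G.
rewrite !rev_eq_nil /= -!rev_cat -!catA => c1 c2 hG /mirror_hom2 hs.
have [r [hr rP]] := U D1 D2 G s c2 c1 hG hs.
by exists r; split=> [|r' /E/rP //]; apply/E.
Qed.

Lemma mirror_binary (t : cell2 X) (a b c : cell1 X) :
  [/\ @hom2 mirror t [:: b; a] [:: c] <-> hom2 t [:: a; b] [:: c],
      hom2 t [:: a; b] [:: c] ->
        (@universal_out mirror 0 t <-> universal_out 0 t),
      hom2 t [:: a; b] [:: c] ->
        (@universal_inp mirror 0 t <-> universal_inp 1 t) &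
      hom2 t [:: a; b] [:: c] ->
        (@universal_inp mirror 1 t <-> universal_inp 0 t)].
Proof.
split; first exact: (mirror_hom2 t [:: a; b] [:: c]).
- by case=> _ ot; exact: (mirror_universal_out (D1 := [::]) ot).
- by case=> it _; exact: (mirror_universal_inp (G1 := [:: a]) (G2 := [::]) it).
- by case=> it _; exact: (mirror_universal_inp (G1 := [::]) (G2 := [:: b]) it).
Qed.

Lemma mirror_left (t : cell2 X) (a b c : cell1 X) :
  [/\ @hom2 mirror t [:: b; a] [:: c], @universal_out mirror 0 t &
      @universal_inp mirror 1 t] <->
  [/\ hom2 t [:: a; b] [:: c], universal_out 0 t & universal_inp 0 t].
Proof.
have [E U _ V] := mirror_binary t a b c.
by split=> -[h1 h2 h3]; split; tauto.
Qed.

Lemma mirror_right (t : cell2 X) (a b c : cell1 X) :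
  [/\ @hom2 mirror t [:: b; a] [:: c], @universal_out mirror 0 t &
      @universal_inp mirror 0 t] <->
  [/\ hom2 t [:: a; b] [:: c], universal_out 0 t & universal_inp 1 t].
Proof.
have [E U V _] := mirror_binary t a b c.
by split=> -[h1 h2 h3]; split; tauto.
Qed.

Lemma mirror_tensor_unit (x : cell0 X) (i : cell1 X) :
  @tensor_unit mirror x i <-> tensor_unit x i.
Proof.
split=> -[[h1 h2] L R]; split=> // [y a [ha1 ha2]|z b [hb1 hb2]].
- by have [//|r /mirror_right hr] := R y a; exists r.
- by have [//|l /mirror_left hl] := L z b; exists l.
- by have [//|r hr] := R y a; exists r; apply/mirror_left.
- by have [//|l hl] := L z b; exists l; apply/mirror_right.
Qed.

Lemma mirror_tensor_left_universal (e : cell1 X) :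
  @tensor_left_universal mirror e <-> tensor_right_universal e.
Proof.
split=> -[H1 H2]; split=> z b [hb1 hb2].
- by have [//|u [t [[hu1 hu2] ht to ti]]] := H1 z b; exists u, t;
    have /mirror_left[? ? ?] := And3 ht to ti.
- by have [//|u [t [[hu1 hu2] ht to ti]]] := H2 z b; exists u, t;
    have /mirror_left[? ? ?] := And3 ht to ti.
- by have [//|u [t [[hu1 hu2] ht to ti]]] := H1 z b; exists u, t;
    have /mirror_left[? ? ?] := And3 ht to ti.
- by have [//|u [t [[hu1 hu2] ht to ti]]] := H2 z b; exists u, t;
    have /mirror_left[? ? ?] := And3 ht to ti.
Qed.

Lemma mirror_tensor_right_universal (e : cell1 X) :
  tensor_left_universal e -> @tensor_right_universal mirror e.
Proof.
move=> [H1 H2]; split=> z b [hb1 hb2].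
- by have [//|u [t [[hu1 hu2] ht to ti]]] := H1 z b; exists u, t;
    have /mirror_right[? ? ?] := And3 ht to ti.
- by have [//|u [t [[hu1 hu2] ht to ti]]] := H2 z b; exists u, t;
    have /mirror_right[? ? ?] := And3 ht to ti.
Qed.

Lemma mirror_tensor_universal (e : cell1 X) :
  tensor_universal e -> @tensor_universal mirror e.
Proof.
move=> [L R]; split; first exact/mirror_tensor_left_universal.
exact: mirror_tensor_right_universal.
Qed.

Lemma mirror_unital : unital X -> unital mirror.
Proof.
move=> U a; have [t [ht tl tr]] := U a; exists t; have [it ot] := ht; split.
- exact/(mirror_hom2 t [:: a] [:: a]).
- move=> i s /mirror_cuttable[c _ _]; rewrite ot in c.
  by rewrite /= /mirror_cut ot; apply: tl.
- move=> j s /mirror_cuttable[c _ _]; rewrite it in c.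
  by rewrite /= /mirror_cut it; apply: tr.
Qed.

Lemma mirror_out_univ (t : cell2 X) (a b c : cell1 X) :
  out_univ t [:: a; b] c -> @out_univ mirror t [:: b; a] c.
Proof.
move=> to; have [ht _ _] := to; have [E U _ _] := mirror_binary t a b c.
have mt := E.2 ht; apply: (universal_outP mt).1.
exact: (U ht).2 ((universal_outP ht).2 to).
Qed.

Lemma mirror_weak_inverse (e e' : cell1 X) :
  weak_inverse e e' -> @weak_inverse mirror e e'.
Proof.
move=> [i [i' [t [t' [[se' te'] ui ui' to to']]]]].
exists i', i, t', t; split; rewrite ?mirror_tensor_unit //.
- exact: mirror_out_univ.
- exact: mirror_out_univ.
Qed.

Lemma mirror_tensor_1_representable :
  tensor_1_representable X -> tensor_1_representable mirror.
Proof.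
move=> [U R]; split; first exact: mirror_unital.
move=> x y z a b [ha1 ha2] [hb1 hb2].
have [//|//|c [t [ht to]]] := R z y x b a; exists c, t.
by have [E F _ _] := mirror_binary t b a c; split; [apply/E|apply/(F ht)].
Qed.

Lemma mirror_right_1_closed : left_1_closed X -> right_1_closed mirror.
Proof.
move=> [U R]; split; first exact: mirror_unital.
move=> x y z a b [ha1 ha2] [hb1 hb2].
have [//|//|u [t [[hu1 hu2] ht ti]]] := R z y x a b; exists u, t.
by have [E _ _ F] := mirror_binary t u a b; split; [|apply/E|apply/(F ht)].
Qed.

End Mirror.

(** * Preservation of tensor universal 1-cells *)

Lemma weak_inverse_tensor_universal (X : polybicategory) (e e' : cell1 X) :
  unital X -> tensor_1_representable X \/ (right_1_closed X /\ left_1_closed X) ->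
  weak_inverse e e' -> tensor_universal e.
Proof.
move=> hX hrep inv; split.
  apply: weak_inverse_left_universal inv => //.
  by case: hrep => [|[]]; [left|right].
apply/mirror_tensor_left_universal.
apply: (@weak_inverse_left_universal (mirror X) _ _ e' _ (mirror_weak_inverse inv)).
  exact: mirror_unital.
by case: hrep => [/mirror_tensor_1_representable|[_ /mirror_right_1_closed]]; [left|right].
Qed.

Lemma tensor_universal_has_inverse (X : polybicategory) (e : cell1 X) :
  tensor_universal e -> exists e', weak_inverse e e'.
Proof.
move=> ue; have [i [_ [ui _ _]]] := tensor_universal_unit (mirror_tensor_universal ue).
by apply: tensor_universal_weak_inverse ue _; apply/mirror_tensor_unit; exact: ui.
Qed.

Lemma map_weak_inverse (X Y : polybicategory) (f : morphism X Y) (e e' : cell1 X) :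
  preserves_tensor_units f -> preserves_tensors f ->
  weak_inverse e e' -> weak_inverse (map1 f e) (map1 f e').
Proof.
move=> fu ft [i [i' [t [t' [[se' te'] ui ui' to to']]]]].
have image a b c s : out_univ s [:: a; b] c ->
    out_univ (map2 f s) [:: map1 f a; map1 f b] (map1 f c).
  move=> so; have [hs _ _] := so.
  have [|hfs fso] := ft a b c s; first by split=> //; apply/(universal_outP hs).
  exact/(universal_outP hfs).
exists (map1 f i), (map1 f i'), (map2 f t), (map2 f t').
rewrite /hom1 !map_src !map_tgt se' te'.
by split=> //; [exact: fu|exact: fu|exact: image|exact: image].
Qed.

Theorem corollary3p20 (X Y : polybicategory) (f : morphism X Y)
    (hX : unital X) (hY : unital Y)
    (f_unital : unital_morphism f)
    (f_tensor_units : preserves_tensor_units f)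
    (f_tensors : preserves_tensors f)
    (hrep : tensor_1_representable Y \/ (right_1_closed Y /\ left_1_closed Y)) :
  tensor_strong f.
Proof.
split=> // e ue; have [e' inv] := tensor_universal_has_inverse ue.
exact: weak_inverse_tensor_universal hY hrep (map_weak_inverse f_tensor_units f_tensors inv).
Qed.
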